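(* One has $m(3)=5$ and $m(4)=7$. Up to isomorphism, $T_5^{\ast}$ is the unique tournament $T$ of order five with $\vec{\chi}_a(T)\geq 3$, and the tournaments $T$ of order seven with $\vec{\chi}_a(T)\geq 4$ are, up to isomorphism, precisely $P_7$ and $Q_7$. Moreover $\vec{\chi}_a(T_5^{\ast})=3$, $\vec{\chi}_a(P_7)=4$ and $\vec{\chi}_a(Q_7)=4$.
   Context: All digraphs are finite and nonempty, with no loops and no parallel arcs. An oriented graph is a digraph with no pair of opposite arcs; a tournament is an oriented graph in which exactly one of $uv$, $vu$ is an arc for every pair of distinct vertices. Write $u\to v$ when $uv$ is an arc, and $X\Rightarrow Y$ when every vertex of $X$ dominates every vertex of $Y$. A digraph is acyclic if it has no directed cycle. For disjoint $X,Y\subseteq V(D)$, $D[X,Y]$ is the bipartite subdigraph on $X\cup Y$ whose arcs are all arcs of $D$ with one end in $X$ and the other in $Y$. An acyclic $q$-dicolouring of an oriented graph $D$ is a partition of $V(D)$ into nonempty classes $C_1,\ldots,C_q$ such that every $D[C_i]$ is acyclic and every $D[C_i,C_j]$ with $i\neq j$ is acyclic; $\vec{\chi}_a(D)$ is the minimum such $q$. For $k\geq1$, $$m(k)=\min\{|V(D)|: D\text{ is a finite oriented graph and }\vec{\chi}_a(D)\geq k\}.$$ $T_5^{\ast}$ is the tournament with vertex set $\{h,\ell,m_0,m_1,m_2\}$ where $M=\{m_0,m_1,m_2\}$ induces the directed triangle $m_0\to m_1\to m_2\to m_0$, and $\{h\}\Rightarrow M\Rightarrow\{\ell\}$, $\ell\to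 h$. $P_7$ is the Paley tournament on $\mathbb{Z}_7$, with $x\to y$ whenever $y-x\in\{1,2,4\}$ modulo $7$. $Q_7$ is the tournament on $\{x_1,x_2,x_3,x_4,u,v,w\}$ defined as follows: $x_i\to x_j$ for $1\le i<j\le 4$; for $y\in\{u,v,w\}$ put $S_X(y)=\{i\in\{1,2,3,4\}: y\to x_i\}$ (so $x_i\to y$ for $i\notin S_X(y)$); then $S_X(u)=\{2\}$, $S_X(w)=\{1,3\}$, $S_X(v)=\{1,4\}$; and $w\to u$, $u\to v$, $w\to v$. *)

(* Defs.v *)
From HB Require Import structures.
From mathcomp Require Import all_boot ssralg zmodp.

Set Implicit Arguments.
Unset Strict Implicit.
Unset Printing Implicit Defensive.

Record oriented_graph := OrientedGraph {
  vertex :> finType;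
  arc : rel vertex;
  loopless : forall x, ~~ arc x x;
  no_opposite : forall x y, arc x y -> ~~ arc y x;
  nonempty : 0 < #|vertex| }.

Arguments arc : clear implicits.

Definition tournament (D : oriented_graph) : Prop :=
  forall x y : D, x != y -> arc D x y (+) arc D y x.

Definition isomorphic (D D' : oriented_graph) : Prop :=
  exists f : D -> D',
    bijective f /\ (forall x y : D, arc D' (f x) (f y) = arc D x y).

(* A directed cycle is a nonempty cyclic sequence of distinct vertices, so its
   length is at most #|T|; this makes acyclicity a boolean (see acyclicP). *)
Definition acyclic (T : finType) (e : rel T) : bool :=
  [forall n : 'I_#|T|, forall c : (n.+1).-tuple T, ~~ ucycleb e c].

Lemma acyclicP (T : finType) (e : rel T) :
  reflect (forall c : seq T, ucycle e c -> c = [::]) (acyclic e).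
Proof.
apply: (iffP forallP) => [acy [|x c] // cyc | acy n].
  have szc : size c < #|T| by have [_ /card_uniqP szE] := andP cyc; rewrite -[_ < _]/(size (x :: c) <= _) -szE max_card.
  by have /forallP/(_ (in_tuple (x :: c)))/negP[] := acy (Ordinal szc).
apply/forallP => c; apply/negP => /acy c0.
by have := size_tuple c; rewrite c0.
Qed.

(* The subdigraphs D[C] and D[X, Y] are represented by their arc relations on
   the whole vertex set: isolated vertices do not affect acyclicity. *)
Definition induced (D : oriented_graph) (C : {set D}) : rel D :=
  [rel x y | [&& x \in C, y \in C & arc D x y]].

Definition between (D : oriented_graph) (X Y : {set D}) : rel D :=
  [rel x y | ((x \in X) && (y \in Y) || (x \in Y) && (y \in X)) && arc D x y].

(* partition P [set: D] includes the nonemptiness of the classes. *)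
Definition acyclic_dicolouring (D : oriented_graph) (P : {set {set D}}) : bool :=
  [&& partition P [set: D],
      [forall C in P, acyclic (induced C)] &
      [forall C in P, forall C' in P, (C != C') ==> acyclic (between C C')]].

Definition acyclic_dicolourable (D : oriented_graph) (q : nat) : bool :=
  [exists P : {set {set D}}, acyclic_dicolouring P && (#|P| == q)].

(* The partition into singletons is an acyclic dicolouring. *)
Lemma acyclic_dicolourable_ex (D : oriented_graph) :
  exists q, acyclic_dicolourable D q.
Proof.
pose P := [set [set x] | x : D]; exists #|P|; apply/existsP; exists P.
rewrite eqxx andbT; apply/and3P; split.
- apply/and3P; split.
  + rewrite eqEsubset subsetT; apply/subsetP => x _.
    by apply/bigcupP; exists [set x]; rewrite ?imset_f ?set11.
  + apply/trivIsetP => _ _ /imsetP[x _ ->] /imsetP[y _ ->].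
    by rewrite (inj_eq set1_inj) disjoints1 inE.
  + apply/imsetP => -[x _ x0].
    by have := set11 x; rewrite -x0 inE.
- apply/forall_inP => _ /imsetP[x _ ->]; apply/acyclicP => -[//|a c] /andP[cyc _].
  have [b [/set1P-> /set1P-> xx]] : exists b,
      [/\ a \in [set x], b \in [set x] & arc D a b].
    by case: c cyc => [|b c] /= /andP[/and3P[? ? ?] _]; [exists a | exists b].
  by rewrite (negPf (loopless x)) in xx.
- apply/forall_inP => _ /imsetP[x _ ->]; apply/forall_inP => _ /imsetP[y _ ->].
  apply/implyP => _; apply/acyclicP => -[//|a [|b [|d c]]] /andP[/=].
  + by rewrite /between /= (negPf (loopless a)) andbF.
  + by rewrite /between /= => /and3P[/andP[_ /no_opposite/negPf->]]; rewrite andbF.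
  + rewrite /between /= !inE => /and3P[/andP[H1 _] /andP[H2 _] _].
    rewrite !negb_or => /and4P[/and3P[nab nad _] /andP[nbd _] _ _].
    by case/orP: H1 nab nad nbd => /andP[/eqP-> /eqP->];
      case/orP: H2 => /andP[_ /eqP->]; rewrite ?eqxx ?andbF.
Qed.

Definition dichi (D : oriented_graph) : nat :=
  ex_minn (acyclic_dicolourable_ex D).

(* min_order k n states that m(k) = n, including that the minimum is attained. *)
Definition min_order (k n : nat) : Prop :=
  (exists D : oriented_graph, k <= dichi D /\ #|D| = n) /\
  (forall D : oriented_graph, k <= dichi D -> n <= #|D|).

Variant T5_vertex := T5h | T5l | T5m0 | T5m1 | T5m2.

Definition T5_code (a : T5_vertex) : nat :=
  match a with T5h => 0 | T5l => 1 | T5m0 => 2 | T5m1 => 3 | T5m2 => 4 end.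

Definition T5_decode (n : nat) : T5_vertex :=
  match n with 0 => T5h | 1 => T5l | 2 => T5m0 | 3 => T5m1 | _ => T5m2 end.

Lemma T5_codeK : cancel T5_code T5_decode. Proof. by case. Qed.

HB.instance Definition _ := Countable.copy T5_vertex (can_type T5_codeK).

Lemma T5_enumP : Finite.axiom [:: T5h; T5l; T5m0; T5m1; T5m2].
Proof. by case. Qed.

HB.instance Definition _ := isFinite.Build T5_vertex T5_enumP.

Definition T5_arc : rel T5_vertex := fun a b =>
  match a, b with
  | T5m0, T5m1 | T5m1, T5m2 | T5m2, T5m0 => true
  | T5h, (T5m0 | T5m1 | T5m2) => true
  | (T5m0 | T5m1 | T5m2), T5l => true
  | T5l, T5h => true
  | _, _ => false
  end.

Lemma T5_loopless x : ~~ T5_arc x x. Proof. by case: x. Qed.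

Lemma T5_no_opposite x y : T5_arc x y -> ~~ T5_arc y x.
Proof. by case: x; case: y. Qed.

Lemma T5_nonempty : 0 < #|{: T5_vertex}|. Proof. by apply/card_gt0P; exists T5h. Qed.

Definition T5star : oriented_graph :=
  OrientedGraph T5_loopless T5_no_opposite T5_nonempty.

Definition P7_arc : rel 'Z_7 := fun x y => (y - x)%R \in [:: 1; 2; 4]%R.

Lemma P7_loopless x : ~~ P7_arc x x.
Proof. by rewrite /P7_arc GRing.subrr. Qed.

Lemma P7_no_opposite x y : P7_arc x y -> ~~ P7_arc y x.
Proof.
rewrite /P7_arc -(GRing.opprB y x); case: (y - x)%R => n.
by do 7?[case: n => [//|n]].
Qed.

Lemma P7_nonempty : 0 < #|{: 'Z_7}|. Proof. by rewrite card_ord. Qed.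

Definition P7 : oriented_graph :=
  OrientedGraph P7_loopless P7_no_opposite P7_nonempty.

Variant Q7_vertex := Q7x1 | Q7x2 | Q7x3 | Q7x4 | Q7u | Q7v | Q7w.

Definition Q7_code (a : Q7_vertex) : nat :=
  match a with
  | Q7x1 => 0 | Q7x2 => 1 | Q7x3 => 2 | Q7x4 => 3 | Q7u => 4 | Q7v => 5 | Q7w => 6
  end.

Definition Q7_decode (n : nat) : Q7_vertex :=
  match n with
  | 0 => Q7x1 | 1 => Q7x2 | 2 => Q7x3 | 3 => Q7x4 | 4 => Q7u | 5 => Q7v | _ => Q7w
  end.

Lemma Q7_codeK : cancel Q7_code Q7_decode. Proof. by case. Qed.

HB.instance Definition _ := Countable.copy Q7_vertex (can_type Q7_codeK).

Lemma Q7_enumP :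
  Finite.axiom [:: Q7x1; Q7x2; Q7x3; Q7x4; Q7u; Q7v; Q7w].
Proof. by case. Qed.

HB.instance Definition _ := isFinite.Build Q7_vertex Q7_enumP.

Definition Q7_SX (y : Q7_vertex) : seq Q7_vertex :=
  match y with
  | Q7u => [:: Q7x2]
  | Q7w => [:: Q7x1; Q7x3]
  | Q7v => [:: Q7x1; Q7x4]
  | _ => [::]
  end.

Definition Q7_arc : rel Q7_vertex := fun a b =>
  match a, b with
  | (Q7u | Q7v | Q7w), (Q7x1 | Q7x2 | Q7x3 | Q7x4) => b \in Q7_SX a
  | (Q7x1 | Q7x2 | Q7x3 | Q7x4), (Q7u | Q7v | Q7w) => a \notin Q7_SX b
  | Q7x1, (Q7x2 | Q7x3 | Q7x4) | Q7x2, (Q7x3 | Q7x4) | Q7x3, Q7x4 => true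
  | Q7w, Q7u | Q7u, Q7v | Q7w, Q7v => true
  | _, _ => false
  end.

Lemma Q7_loopless x : ~~ Q7_arc x x. Proof. by case: x. Qed.

Lemma Q7_no_opposite x y : Q7_arc x y -> ~~ Q7_arc y x.
Proof. by case: x; case: y. Qed.

Lemma Q7_nonempty : 0 < #|{: Q7_vertex}|. Proof. by apply/card_gt0P; exists Q7u. Qed.

Definition Q7 : oriented_graph :=
  OrientedGraph Q7_loopless Q7_no_opposite Q7_nonempty.

(* Main.v *)
From mathcomp Require Import all_boot ssralg zmodp.
Require Import Defs.

(* A colouring of a tournament is good iff no directed triangle is monochromatic
   and no directed 4-cycle has equal colours at opposite vertices.  A tournament
   of order 5 contains a transitive triple.  One of order 7 either contains a
   transitive quadruple (and the other three vertices form a path), or has a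
   vertex whose in- and out-neighbourhoods are directed triangles.  After fixing
   these arcs, a pruned search over the remaining ones settles the matter: one
   of a short list of colourings is good, or the tournament is isomorphic to
   T5star, P7 or Q7.  An oriented graph with fewer than n vertices embeds in a
   tournament of order n with a source, while none of T5star, P7, Q7 has a
   source; this gives the lower bounds on m(3) and m(4). *)

Set Implicit Arguments.
Unset Strict Implicit.
Unset Printing Implicit Defensive.

(** * Acyclic dicolourings as vertex labellings *)

Definition colour_class (T : finType) (c : T -> nat) (i : nat) : {set T} :=
  [set x | c x == i].

Lemma acyclic_hom (T T' : finType) (e : rel T) (e' : rel T') (f : T -> T') :
  injective f -> {homo f : x y / e x y >-> e' x y} -> acyclic e' -> acyclic e.
Proof.
move=> inj_f homf /acyclicP acy; apply/acyclicP => s /andP[cyc uniq_s].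
suff /acy: ucycle e' (map f s) by case: s {cyc uniq_s}.
by rewrite /ucycle map_inj_uniq // uniq_s andbT; apply: homo_cycle cyc.
Qed.

Lemma between_classE (D : oriented_graph) (c : D -> nat) i j x y :
  between (colour_class c i) (colour_class c j) x y =
  ((c x == i) && (c y == j) || (c x == j) && (c y == i)) && arc D x y.
Proof. by rewrite /between /= !inE. Qed.

Lemma dichi_leP (D : oriented_graph) (q : nat) :
  dichi D <= q <->
  exists2 c : D -> nat, forall x, c x < q
    & forall i j, acyclic (between (colour_class c i) (colour_class c j)).
Proof.
rewrite /dichi; case: ex_minnP => p col_p min_p; split=> [le_pq | [c lt_cq acy_c]].
  have /existsP[P /andP[/and3P[partP acyP acyPP] /eqP cardP]] := col_p.
  have /and3P[/eqP covP trivP P0] := partP.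
  pose k x := index (pblock P x) (enum P).
  have inP x : pblock P x \in enum P by rewrite mem_enum pblock_mem ?covP ?inE.
  exists k => [x | i j].
    by apply: leq_trans le_pq; rewrite -cardP cardE index_mem.
  have classE n x : k x = n -> x \in nth set0 (enum P) n.
    by move=> <-; rewrite nth_index // mem_pblock covP inE.
  have classP n x : k x = n -> nth set0 (enum P) n \in P.
    by move=> <-; rewrite nth_index // -mem_enum.
  (* A label that no vertex carries only names the default [set0]. A relation that is not acyclic
     has an arc, and its ends carry the labels i and j, so both name blocks of [P]. *)
  case: (boolP (acyclic _)) => // nacy.
  have [x [y]] : exists x y, between (colour_class k i) (colour_class k j) x y.
    move: (between _ _) nacy => e nacy; case: (pickP (fun z : D * D => e z.1 z.2)).
      by move=> [x y] exy; exists x, y.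
    move=> no_e; have {}no_e x y : e x y = false := no_e (x, y).
    case/negP: nacy; apply/acyclicP => -[//|a s] /andP[].
    by case: s => [|b s]; rewrite /= no_e.
  rewrite between_classE => /andP[ij _].
  have [iP jP] : nth set0 (enum P) i \in P /\ nth set0 (enum P) j \in P.
    by case/orP: ij => /andP[/eqP/classP ? /eqP/classP ?].
  case/negP: nacy; have [eq_ij | neq_ij] := eqVneq (nth set0 (enum P) i) (nth set0 (enum P) j).
    have /forall_inP/(_ _ iP) := acyP.
    apply: (@acyclic_hom _ _ _ _ id) => // a b; rewrite between_classE /induced /=.
    by case/andP => /orP[] /andP[/eqP/classE ina /eqP/classE inb] ->;
      move: ina inb; rewrite -eq_ij => -> ->.
  have /forall_inP/(_ _ iP)/forall_inP/(_ _ jP)/implyP/(_ neq_ij) := acyPP.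
  apply: (@acyclic_hom _ _ _ _ id) => // a b; rewrite between_classE /between /=.
  by case/andP => /orP[] /andP[/eqP/classE -> /eqP/classE ->] ->; rewrite ?orbT.
(* Only labels in use contribute, so no class is empty; [P] may have fewer than q classes, which the
   minimality of p tolerates. *)
pose P := [set colour_class c (c x) | x : D].
have le_Pq : #|P| <= q.
  rewrite -[q]card_ord; apply: leq_trans (leq_imset_card (fun i : 'I_q => colour_class c i) _).
  apply/subset_leq_card/subsetP => _ /imsetP[x _ ->].
  by apply/imsetP; exists (Ordinal (lt_cq x)).
apply: leq_trans le_Pq; apply: min_p; apply/existsP; exists P.
rewrite eqxx andbT; apply/and3P; split.
- apply/and3P; split.
  + rewrite eqEsubset subsetT; apply/subsetP => x _.
    by apply/bigcupP; exists (colour_class c (c x)); rewrite ?imset_f ?inE.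
  + apply/trivIsetP => _ _ /imsetP[x _ ->] /imsetP[y _ ->] neq.
    apply/pred0P => z /=; rewrite !inE; apply/negP => /andP[/eqP zx /eqP zy].
    by case/eqP: neq; rewrite -zx -zy.
  + by apply/imsetP => -[x _] /setP/(_ x); rewrite !inE eqxx.
- apply/forall_inP => _ /imsetP[x _ ->].
  apply: (@acyclic_hom _ _ _ _ id) (acy_c (c x) (c x)) => // a b.
  by rewrite between_classE /induced /= !inE orbb andbA.
- apply/forall_inP => _ /imsetP[x _ ->]; apply/forall_inP => _ /imsetP[y _ ->].
  by apply/implyP.
Qed.

(** A colouring of [D'] pulls back along f, since f maps cycles to cycles. Arcs of [D'] need not
    come from [D], so the lemma also covers the addition of arcs. *)
Lemma dichi_mono (D D' : oriented_graph) (f : D -> D') :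
  injective f -> {homo f : x y / arc D x y >-> arc D' x y} -> dichi D <= dichi D'.
Proof.
move=> inj_f homf; have /dichi_leP[c lt_c acy_c] := leqnn (dichi D').
apply/dichi_leP; exists (c \o f) => [x | i j]; first exact: lt_c.
apply: acyclic_hom inj_f _ (acy_c i j) => x y.
by rewrite !between_classE /= => /andP[-> /homf ->].
Qed.

Lemma isomorphic_sym (D D' : oriented_graph) : isomorphic D D' -> isomorphic D' D.
Proof.
case=> f [[g fK gK] arcf]; exists g; split; first by exists f.
by move=> x y; rewrite -arcf !gK.
Qed.

Lemma isomorphic_dichi (D D' : oriented_graph) : isomorphic D D' -> dichi D = dichi D'.
Proof.
move=> iso; apply/eqP; rewrite eqn_leq; apply/andP.
have [f [/bij_inj injf arcf]] := iso.
have [g [/bij_inj injg arcg]] := isomorphic_sym iso.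
by split; [apply: (dichi_mono injf) | apply: (dichi_mono injg)] => x y; rewrite ?arcf ?arcg.
Qed.

Lemma isomorphic_card (D D' : oriented_graph) : isomorphic D D' -> #|D| = #|D'|.
Proof. by case=> f [/bij_eq_card ->]. Qed.

Lemma isomorphic_tournament (D D' : oriented_graph) :
  isomorphic D D' -> tournament D' -> tournament D.
Proof.
case=> f [/bij_inj injf arcf] tourD' x y neq.
by rewrite -!arcf tourD' // (inj_eq injf).
Qed.

Lemma isomorphic_inneighbour (D D' : oriented_graph) :
  isomorphic D D' -> (forall y : D', exists x, arc D' x y) ->
  forall y : D, exists x, arc D x y.
Proof.
case=> f [[g fK gK] arcf] inD' y; have [x xy] := inD' (f y).
by exists (g x); rewrite -arcf gK.
Qed.

(** * Short cycles suffice in tournaments *)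

Definition short_cycle_free (D : oriented_graph) (c : D -> nat) : Prop :=
  (forall x y z, arc D x y -> arc D y z -> c x = c z -> c x = c y -> ~~ arc D z x) /\
  (forall x y z t, arc D x y -> arc D y z -> c x = c z -> c y = c t ->
     arc D z t -> ~~ arc D t x).

Lemma arc_neq (D : oriented_graph) (x y : D) : arc D x y -> x != y.
Proof. by apply: contraTneq => ->; apply: loopless. Qed.

(* In a closed walk alternating between two (possibly equal) classes, either
   x4 -> x1 closes a short cycle with x1 -> x2 -> x3 -> x4, or x1 -> x4
   shortcuts the walk. *)
Lemma short_cycle_freeP (T : oriented_graph) (c : T -> nat) :
  tournament T ->
  short_cycle_free c <->
  forall i j, acyclic (between (colour_class c i) (colour_class c j)).
Proof.
move=> tourT; split=> [[no3 no4] i j | acy].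
  set e := between _ _.
  have eE x y : e x y -> arc T x y by rewrite /e between_classE => /andP[].
  have e2 x y z : e x y -> e y z -> c x = c z.
    rewrite /e !between_classE => /andP[/orP[] /andP[/eqP-> /eqP yE] _] /andP[];
    by rewrite yE => /orP[] /andP[/eqP ? /eqP ?]; congruence.
  have e4 x y z t : e x y -> e y z -> e z t -> arc T x t -> e x t.
    move=> exy eyz ezt axt; move: exy; rewrite /e !between_classE -(e2 _ _ _ eyz ezt).
    by rewrite axt andbT => /andP[].
  apply/acyclicP => s /andP[cyc _]; move: e eE e2 e4 cyc => e eE e2 e4 cyc.
  have [n] := ubnP (size s); elim: n s cyc => // n IHn.
  case=> [|x [|y [|z [|t s]]]] //=.
  - by move/andP=> [/eE]; rewrite (negPf (loopless x)).
  - by move=> /and3P[/eE/no_opposite nyx /eE]; rewrite (negPf nyx).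
  - move=> /and4P[exy eyz ezx _] _.
    have := no3 x y z (eE _ _ exy) (eE _ _ eyz) (e2 _ _ _ exy eyz).
    by rewrite (eE _ _ ezx) (e2 _ _ _ eyz ezx) => /(_ erefl).
  - move=> /and4P[exy eyz ezt pt]; rewrite !ltnS => lt_sn.
    (* The induction does not keep the vertices of the walk distinct. If t = x, then x, y, z is a
       triangle, and the colour equalities make it monochromatic. *)
    have [etx | neq] := eqVneq t x.
      have := no3 x y z (eE _ _ exy) (eE _ _ eyz) (e2 _ _ _ exy eyz).
      have := e2 _ _ _ eyz ezt; rewrite etx => -> /(_ erefl).
      by rewrite -{1}etx (eE _ _ ezt).
    have := tourT t x neq; case axt: (arc T x t); [move=> _ | rewrite addbF => atx].
      suff : [:: x, t & s] = [::] by [].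
      apply: IHn; last exact: ltnW.
      by rewrite /= (e4 _ _ _ _ exy eyz ezt axt).
    have := no4 x y z t (eE _ _ exy) (eE _ _ eyz) (e2 _ _ _ exy eyz)
                 (e2 _ _ _ eyz ezt) (eE _ _ ezt).
    by rewrite atx.
split=> [x y z axy ayz cxz cxy | x y z t axy ayz cxz cyt azt].
  apply/negP => azx; have /acyclicP/(_ [:: x; y; z]) := acy (c x) (c x).
  suff cyc : ucycle (between (colour_class c (c x)) (colour_class c (c x))) [:: x; y; z].
    by move/(_ cyc).
  rewrite /ucycle /= !between_classE -cxz -cxy !eqxx axy ayz azx /= !inE !negb_or.
  by rewrite (arc_neq axy) (arc_neq ayz) eq_sym (arc_neq azx).
apply/negP => atx; have /acyclicP/(_ [:: x; y; z; t]) := acy (c x) (c y).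
suff cyc : ucycle (between (colour_class c (c x)) (colour_class c (c y))) [:: x; y; z; t].
  by move/(_ cyc).
rewrite /ucycle /= !between_classE -cxz -cyt !eqxx axy ayz azt atx /= !orbT !inE !negb_or.
rewrite !(arc_neq axy, arc_neq ayz, arc_neq azt) [x == t]eq_sym (arc_neq atx) andbT /=.
rewrite !andbT; apply/andP; split.
  by apply: contraTneq axy => ->; apply: no_opposite.
by apply: contraTneq ayz => ->; apply: no_opposite.
Qed.

(** * Transitive and cyclic triples in small tournaments *)

Section Structure.

Variables (T : oriented_graph) (tourT : tournament T).

Lemma tournament_arcP (x y : T) : x != y -> arc T x y \/ arc T y x.
Proof. by move/tourT; case: (arc T x y); [left | right]. Qed.

Lemma tournament_arcN (x y : T) : x != y -> arc T x y = ~~ arc T y x.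
Proof. by move/tourT; case: (arc T x y); case: (arc T y x). Qed.

Definition transitive_triple (A : {set T}) : Prop :=
  exists x y z, [/\ x \in A, y \in A & z \in A] /\ [/\ arc T x y, arc T x z & arc T y z].

Definition cyclic_triple (A : {set T}) : Prop :=
  exists x y z, [/\ x \in A, y \in A & z \in A] /\ [/\ arc T x y, arc T y z & arc T z x].

Definition outs (v : T) : {set T} := [set x | arc T v x].
Definition ins (v : T) : {set T} := [set x | arc T x v].

Lemma outs_ins (A : {set T}) v :
  v \in A -> #|A| = (#|A :&: outs v| + #|A :&: ins v|).+1.
Proof.
move=> vA; rewrite (cardsD1 v) vA add1n -(cardsID (outs v)); congr (_ + _).+1.
  apply/eq_card => x; rewrite !inE; case: eqP => //= ->.
  by rewrite (negPf (loopless v)) andbF.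
apply/eq_card => x; rewrite !inE; have [->|neq] := eqVneq x v.
  by rewrite (negPf (loopless v)) !andbF.
by rewrite (tournament_arcN neq) /= andbC.
Qed.

Lemma pair_arc (A : {set T}) : 1 < #|A| -> exists x y, [/\ x \in A, y \in A & arc T x y].
Proof.
case/card_gt1P=> x [y [xA yA /tournament_arcP[xy|yx]]]; first by exists x, y.
by exists y, x.
Qed.

(** A vertex with at least three others has two out-neighbours or two in-neighbours; the arc between
    these two completes a transitive triple. *)
Lemma exists_transitive_triple (A : {set T}) : 3 < #|A| -> transitive_triple A.
Proof.
move=> A_gt3; have /card_gt0P[v vA] : 0 < #|A| by apply: leq_trans A_gt3.
have := A_gt3; rewrite (outs_ins vA) ltnS => gt2.
have /orP[] : (1 < #|A :&: outs v|) || (1 < #|A :&: ins v|).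
- by case: #|_| gt2 => [|[|n]] //; case: #|_| => [|[|m]].
- case/pair_arc => x [y []]; rewrite !inE => /andP[xA vx] /andP[yA vy] xy.
  by exists v, x, y.
- case/pair_arc => x [y []]; rewrite !inE => /andP[xA xv] /andP[yA yv] xy.
  by exists x, y, v.
Qed.

Lemma transitive_or_cyclic (A : {set T}) :
  2 < #|A| -> transitive_triple A \/ cyclic_triple A.
Proof.
case/card_gt2P => x [y [z [[xA yA zA]]]].
case=> /tournament_arcP xy /tournament_arcP yz /tournament_arcP zx.
case: xy yz zx => [] xy [] yz [] zx;
  by [left; exists x, y, z | left; exists y, z, x
  | left; exists z, x, y | left; exists x, z, y | left; exists z, y, x | left; exists y, x, z
  | right; exists x, y, z | right; exists x, z, y].
Qed.

(** Transitive and cyclic triples both contain a directed path. The condition on the ends keeps the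
    three vertices distinct without fixing the third arc. *)
Lemma triple_path (A : {set T}) : 2 < #|A| ->
  exists x y z, [/\ x \in A, y \in A & z \in A] /\ [/\ arc T x y, arc T y z & x != z].
Proof.
case/transitive_or_cyclic => -[x [y [z [inA [xy yz zx]]]]]; exists x, y, z.
  by split=> //; split=> //; apply: arc_neq.
by split=> //; split=> //; rewrite eq_sym; apply: arc_neq.
Qed.

(** A vertex v has six neighbours. Four on one side contain a transitive triple, which v extends to
    a quadruple; otherwise there are three on each side, and each of these triples is transitive or
    cyclic. *)
Lemma transitive_quadruple_or_cyclic_neighbourhoods : #|T| = 7 ->
  (exists x1 x2 x3 x4, [/\ arc T x1 x2, arc T x1 x3 & arc T x1 x4]
     /\ [/\ arc T x2 x3, arc T x2 x4 & arc T x3 x4]) \/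
  (exists v, cyclic_triple (outs v) /\ cyclic_triple (ins v)).
Proof.
move=> T7; have /card_gt0P[v _] : 0 < #|[set: T]| by rewrite cardsT T7.
have out_tt : transitive_triple (outs v) -> exists x1 x2 x3 x4,
    [/\ arc T x1 x2, arc T x1 x3 & arc T x1 x4]
     /\ [/\ arc T x2 x3, arc T x2 x4 & arc T x3 x4].
  case=> x [y [z [[]]]]; rewrite !inE => vx vy vz [xy xz yz].
  by exists v, x, y, z.
have in_tt : transitive_triple (ins v) -> exists x1 x2 x3 x4,
    [/\ arc T x1 x2, arc T x1 x3 & arc T x1 x4]
     /\ [/\ arc T x2 x3, arc T x2 x4 & arc T x3 x4].
  case=> x [y [z [[]]]]; rewrite !inE => xv yv zv [xy xz yz].
  by exists x, y, z, v.
have := outs_ins (in_setT v); rewrite !setTI cardsT T7 => -[eq6].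
have [out_le3 | /exists_transitive_triple/out_tt] := leqP #|outs v| 3; last by left.
have [in_le3 | /exists_transitive_triple/in_tt] := leqP #|ins v| 3; last by left.
have out_gt2 : 2 < #|outs v|.
  by rewrite -(leq_add2r #|ins v|) -eq6 -[6]/(3 + 3) leq_add2l.
have in_gt2 : 2 < #|ins v|.
  by rewrite -(leq_add2l #|outs v|) -eq6 -[6]/(3 + 3) leq_add2r.
have [/out_tt|cyc_out] := transitive_or_cyclic out_gt2; first by left.
have [/in_tt|cyc_in] := transitive_or_cyclic in_gt2; first by left.
by right; exists v.
Qed.

End Structure.

(** * Embedding into a tournament with a source *)

(** The vertices added to [D] are ordered transitively and dominate [D]; non-adjacent pairs of [D]
    are oriented by [enum_rank]. Since [#|D| < n], at least one vertex is added, and the first one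
    is a source. *)
Lemma tournament_with_source (D : oriented_graph) (n : nat) : #|D| < n ->
  exists T : oriented_graph,
    [/\ tournament T, #|T| = n, dichi D <= dichi T & exists s, forall x, ~~ arc T x s].
Proof.
move=> lt_Dn; pose V := ('I_(n - #|D|) + D)%type.
pose e (a b : V) := match a, b with
  | inl i, inl j => i < j
  | inl _, inr _ => true
  | inr _, inl _ => false
  | inr x, inr y => arc D x y || ~~ arc D y x && (enum_rank x < enum_rank y)
  end.
have e_loopless x : ~~ e x x.
  by case: x => [i|x] /=; rewrite ltnn // (negPf (loopless x)).
have e_no_opposite x y : e x y -> ~~ e y x.
  case: x y => [i|x] [j|y] //=; first by case: ltngtP.
  case/orP => [xy|/andP[/negPf-> lt_xy]]; first by rewrite (negPf (no_opposite xy)) xy.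
  by rewrite negb_and -leqNgt (ltnW lt_xy) orbT.
have e_tour x y : x != y -> e x y (+) e y x.
  case: x y => [i|x] [j|y] //= neq.
    by case: ltngtP => // /val_inj eq_ij; rewrite eq_ij eqxx in neq.
  case axy: (arc D x y); case ayx: (arc D y x) => //=.
    by rewrite (negPf (no_opposite axy)) in ayx.
  by case: ltngtP => // /val_inj/enum_rank_inj eq_xy; rewrite eq_xy eqxx in neq.
have cardV : #|{: V}| = n by rewrite card_sum card_ord subnK // ltnW.
have V_gt0 : 0 < #|{: V}| by rewrite cardV; apply: leq_trans lt_Dn.
exists (OrientedGraph e_loopless e_no_opposite V_gt0); split=> //.
  apply: (@dichi_mono _ (OrientedGraph e_loopless e_no_opposite V_gt0) inr).
    by move=> x y [].
  by move=> x y /= ->.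
have lt0 : 0 < n - #|D| by rewrite subn_gt0.
by exists (inl (Ordinal lt0)) => -[i|x] /=.
Qed.

(** * Coded tournaments and the pruned search *)

(* Short-circuiting variants: [||] and [&&] are strict under call by value. *)
Fixpoint lazy_all (A : Type) (P : A -> bool) (s : seq A) : bool :=
  if s is x :: s' then (if P x then lazy_all P s' else false) else true.

Fixpoint lazy_has (A : Type) (P : A -> bool) (s : seq A) : bool :=
  if s is x :: s' then (if P x then true else lazy_has P s') else false.

Lemma lazy_allE (A : Type) (P : A -> bool) s : lazy_all P s = all P s.
Proof. by elim: s => //= x s ->; case: (P x). Qed.

Lemma lazy_hasE (A : Type) (P : A -> bool) s : lazy_has P s = has P s.
Proof. by elim: s => //= x s ->; case: (P x). Qed.

(* A tournament on 0, ..., n - 1 is coded by its lower triangular rows: for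
   j < i, [lookup m i j] says whether i -> j.  In a partial code (fewer than n
   rows), both directions of an undecided arc are present. *)
Definition lookup (m : seq bitseq) (i j : nat) : bool := nth false (nth [::] m i) j.

Definition code_arc (m : seq bitseq) : rel nat := fun i j =>
  if i < j then (if j < size m then ~~ lookup m j i else true)
  else if j < i then (if i < size m then lookup m i j else true) else false.

(** The ends x and z are chosen first, so that their colours are compared before any arc is
    inspected. The tests [x == z] and [y == t] matter for partial codes, where an undecided pair
    would otherwise yield degenerate closed walks. *)
Definition avoids (n : nat) (e : rel nat) (k : seq nat) : bool :=
  let I := iota 0 n in
  let c := nth 0 k in
  lazy_all (fun x => lazy_all (fun z =>
    if x == z then true else if c x != c z then true else
    lazy_all (fun y => if ~~ e x y then true else if ~~ e y z then true else
      if (if c x == c y then e z x else false) then false else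
      lazy_all (fun t => if c y != c t then true else if y == t then true else
        if e z t then ~~ e t x else true) I) I) I) I.

Lemma avoidsP (n : nat) (e : rel nat) (k : seq nat) :
  reflect (forall x y z, x < n -> y < n -> z < n -> x != z -> nth 0 k x = nth 0 k z ->
     e x y -> e y z -> (nth 0 k x = nth 0 k y -> ~~ e z x) /\
     (forall t, t < n -> y != t -> nth 0 k y = nth 0 k t -> e z t -> ~~ e t x))
    (avoids n e k).
Proof.
rewrite /avoids lazy_allE; apply: (iffP allP) => [av x y z ltx lty ltz xz cxz exy eyz | av x].
  have := av x; rewrite mem_iota lazy_allE => /(_ ltx)/allP/(_ z); rewrite mem_iota => /(_ ltz).
  rewrite (negPf xz) cxz eqxx /= lazy_allE => /allP/(_ y); rewrite mem_iota => /(_ lty).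
  rewrite exy eyz /=; case: ifP => // nobad; rewrite lazy_allE => /allP{}av.
  split=> [czy | t ltt yt cyt ezt]; first by move: nobad; rewrite czy eqxx => ->.
  by have := av t; rewrite mem_iota => /(_ ltt); rewrite cyt eqxx (negPf yt) ezt.
rewrite mem_iota lazy_allE => /= ltx; apply/allP => z; rewrite mem_iota /= => ltz.
have [//|xz] := eqVneq x z; have [cxz|//] := eqVneq (nth 0 k x) (nth 0 k z).
rewrite lazy_allE; apply/allP => y; rewrite mem_iota /= => lty.
case exy: (e x y) => //=; case eyz: (e y z) => //=.
have [no3 no4] := av x y z ltx lty ltz xz cxz exy eyz.
have -> : (if nth 0 k x == nth 0 k y then e z x else false) = false.
  by case: eqP => // cxy; apply/negbTE/no3.
rewrite lazy_allE; apply/allP => t; rewrite mem_iota /= => ltt.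
have [cyt|//] := eqVneq (nth 0 k y) (nth 0 k t); have [//|yt] := eqVneq y t.
by case ezt: (e z t) => //; apply: no4.
Qed.

Lemma avoids_sub (n : nat) (e e' : rel nat) (k : seq nat) :
  (forall x y, e' x y -> e x y) -> avoids n e k -> avoids n e' k.
Proof.
move=> sub /avoidsP av; apply/avoidsP => x y z ltx lty ltz xz cxz /sub exy /sub eyz.
have [no3 no4] := av x y z ltx lty ltz xz cxz exy eyz.
split=> [/no3 | t ltt yt cyt /sub ezt]; first exact/contra/sub.
by apply: contra (no4 t ltt yt cyt ezt); apply: sub.
Qed.

(** Further rows only delete arcs, since undecided pairs carry both directions, and deleting arcs
    creates no bad short cycle. *)
Lemma avoids_prefix (n : nat) (m rows : seq bitseq) (k : seq nat) :
  avoids n (code_arc m) k -> avoids n (code_arc (m ++ rows)) k.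
Proof.
apply: avoids_sub => i j; rewrite /code_arc /lookup size_cat !nth_cat.
case: (ltnP i j) => _; first by case: (ltnP j (size m)) => // lt; rewrite ltn_addr.
by case: (ltnP j i) => // _; case: (ltnP i (size m)) => // lt; rewrite ltn_addr.
Qed.

Section Code.

Variables (T : oriented_graph) (tourT : tournament T) (x0 : T) (l : seq T).
Hypotheses (uniq_l : uniq l) (size_l : size l = #|T|).

Definition code : seq bitseq :=
  mkseq (fun i => mkseq (fun j => arc T (nth x0 l i) (nth x0 l j)) i) (size l).

(** Only entries below the diagonal are stored; in a tournament the others are their negations. *)
Lemma code_arcE i j : i < size l -> j < size l ->
  code_arc code i j = arc T (nth x0 l i) (nth x0 l j).
Proof.
move=> lti ltj; rewrite /code_arc /code /lookup size_mkseq lti ltj.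
case: ltngtP => [lt_ij|lt_ji|->]; rewrite ?(nth_mkseq, negPf (loopless _)) //.
by rewrite -tournament_arcN // nth_uniq // neq_ltn lt_ij.
Qed.

Lemma mem_code_seq x : x \in l.
Proof.
have eq_card : #|l| = #|T| by rewrite (card_uniqP uniq_l).
by rewrite (subset_cardP eq_card (subset_predT _)).
Qed.

Lemma dichi_codeP (q : nat) :
  dichi T <= q <->
  exists2 k, size k = size l /\ all (fun c => c < q) k & avoids (size l) (code_arc code) k.
Proof.
split=> [/dichi_leP[c lt_c /(short_cycle_freeP _ tourT)[no3 no4]] | [k [size_k lt_k] /avoidsP av]].
  exists (map c l); first by rewrite size_map; split=> //; apply/allP => _ /mapP[x _ ->].
  apply/avoidsP => x y z ltx lty ltz xz; rewrite !(nth_map x0) // !code_arcE // => cxz axy ayz.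
  split=> [cxy | t ltt yt]; first by apply: (no3 _ (nth x0 l y)).
  by rewrite (nth_map x0) // !code_arcE //; apply: (no4 _ (nth x0 l y)).
apply/dichi_leP; exists (fun x => nth 0 k (index x l)) => [x|].
  by move/all_nthP: lt_k; apply; rewrite size_k index_mem mem_code_seq.
have idx x : index x l < size l by rewrite index_mem mem_code_seq.
have idxE x y : code_arc code (index x l) (index y l) = arc T x y.
  by rewrite code_arcE ?nth_index ?mem_code_seq.
have idx_neq x y : x != y -> index x l != index y l.
  by apply: contra => /eqP eq_xy;
    rewrite -(nth_index x0 (mem_code_seq x)) eq_xy nth_index ?mem_code_seq.
(* The ends of a path with two arcs are distinct because there are no opposite arcs; this supplies
   the inequalities that [avoidsP] asks for. *)
have nback x y z : arc T x y -> arc T y z -> x != z.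
  by move=> xy; apply: contraTneq => <-; apply: no_opposite.
apply/(short_cycle_freeP _ tourT); split=> [x y z xy yz cxz cxy | x y z t xy yz cxz cyt zt].
  have [] := av _ _ _ (idx x) (idx y) (idx z) (idx_neq _ _ (nback _ _ _ xy yz)) cxz.
  - by rewrite idxE.
  - by rewrite idxE.
  - by rewrite idxE => /(_ cxy).
have [] := av _ _ _ (idx x) (idx y) (idx z) (idx_neq _ _ (nback _ _ _ xy yz)) cxz.
- by rewrite idxE.
- by rewrite idxE.
- move=> _ /(_ _ (idx t) (idx_neq _ _ (nback _ _ _ yz zt)) cyt); rewrite !idxE.
  exact.
Qed.

End Code.

Definition isomorphic_codes (n : nat) (m m' : seq bitseq) : bool :=
  lazy_has (fun p => lazy_all (fun i => lazy_all (fun j =>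
      code_arc m i j == code_arc m' (nth 0 p i) (nth 0 p j)) (iota 0 n)) (iota 0 n))
    (permutations (iota 0 n)).

Lemma isomorphic_codesP (T T' : oriented_graph) (x0 : T) (x0' : T')
    (l : seq T) (l' : seq T') :
  tournament T -> tournament T' -> uniq l -> size l = #|T| -> uniq l' -> size l' = #|T'| ->
  size l = size l' -> isomorphic_codes (size l) (code x0 l) (code x0' l') ->
  isomorphic T T'.
Proof.
move=> tourT tourT' ul sl ul' sl' eq_size; rewrite /isomorphic_codes lazy_hasE.
case/hasP => p; rewrite mem_permutations => p_perm; rewrite lazy_allE => /allP iso_p.
have idx x : index x l < size l by rewrite index_mem mem_code_seq.
have up : uniq p by rewrite (perm_uniq p_perm) iota_uniq.
have szp : size p = size l by rewrite (perm_size p_perm) size_iota.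
have ltp i : i < size l -> nth 0 p i < size l'.
  move=> lti; have : nth 0 p i \in iota 0 (size l).
    by rewrite -(perm_mem p_perm) mem_nth // szp.
  by rewrite mem_iota eq_size.
pose f x := nth x0' l' (nth 0 p (index x l)).
have inj_f : injective f.
  move=> x y /eqP; rewrite nth_uniq ?ltp ?idx // nth_uniq ?szp ?idx // => /eqP eq_xy.
  by rewrite -(nth_index x0 (mem_code_seq ul sl x)) eq_xy nth_index ?mem_code_seq.
exists f; split; first by apply: inj_card_bij; rewrite // -sl -sl' eq_size.
move=> x y; have := iso_p (index x l); rewrite mem_iota => /(_ (idx x)).
rewrite lazy_allE => /allP/(_ (index y l)); rewrite mem_iota => /(_ (idx y)).
by rewrite !code_arcE ?ltp ?idx // !nth_index ?mem_code_seq // => /eqP.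
Qed.

(** In a row pattern, [Some b] is an entry fixed by the case at hand and [None] a free one. *)
Fixpoint completions (p : seq (option bool)) : seq bitseq :=
  if p is o :: p' then
    let rows := completions p' in
    if o is Some b then map (cons b) rows else map (cons true) rows ++ map (cons false) rows
  else [:: [::]].

Definition fits (p : seq (option bool)) (r : bitseq) : bool :=
  (size r == size p) && all2 (fun o b => if o is Some b' then b == b' else true) p r.

Lemma mem_completions p r : (r \in completions p) = fits p r.
Proof.
rewrite /fits; elim: p r => [|o p IHp] [|b r] //=.
  case: o => [b|]; rewrite ?mem_cat; [|apply/norP; split]; apply/mapP => -[] //.
rewrite eqSS; have mem_cons b' : (b :: r \in map (cons b') (completions p)) =
    (b == b') && (r \in completions p).
  apply/mapP/andP => [[r' r'in [-> ->]] | [/eqP-> rin]]; first by rewrite eqxx.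
  by exists r.
case: o => [b'|]; first by rewrite mem_cons IHp andbCA.
by rewrite mem_cat !mem_cons -andb_orl IHp; case: b {mem_cons}.
Qed.

(* Extends a partial code row by row along the patterns, cutting a branch as
   soon as one colouring of [L] is good for all its completions. *)
Fixpoint search (n : nat) (L : seq (seq nat)) (targets : seq (seq bitseq))
    (pats : seq (seq (option bool))) (m : seq bitseq) : bool :=
  if lazy_has (avoids n (code_arc m)) L then true else
  if pats is p :: pats' then
    lazy_all (fun r => search n L targets pats' (rcons m r)) (completions p)
  else lazy_has (isomorphic_codes n m) targets.

(** By induction on the patterns: a cut is final by [avoids_prefix], and without a cut the next row
    is among the completions explored. *)
Lemma search_sound n L targets pats m rows :
  search n L targets pats m -> all2 fits pats rows ->
  has (avoids n (code_arc (m ++ rows))) L || has (isomorphic_codes n (m ++ rows)) targets.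
Proof.
have cut m' : has (avoids n (code_arc m')) L -> forall rows',
    has (avoids n (code_arc (m' ++ rows'))) L.
  by move=> Lm rows'; apply: sub_has Lm => k; apply: avoids_prefix.
elim: pats m rows => [|p pats IHp] m [|r rows] //=; rewrite !lazy_hasE.
  by rewrite cats0; case: ifP => // _ ->; rewrite orbT.
case: ifP => [/cut-> // | _]; rewrite lazy_allE => /allP srch /andP[].
rewrite -mem_completions => /srch{}srch rowsP.
by rewrite -cat_rcons; apply: IHp.
Qed.

Lemma search_tournament (T : oriented_graph) (x0 : T) (l : seq T) (q : nat)
    (L : seq (seq nat)) (targets : seq (seq bitseq)) pats m rows :
  tournament T -> uniq l -> size l = #|T| ->
  search (size l) L targets pats m ->
  all (fun k => (size k == size l) && all (fun c => c < q) k) L ->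
  code x0 l = m ++ rows -> all2 fits pats rows ->
  dichi T <= q \/ exists2 t, t \in targets & isomorphic_codes (size l) (code x0 l) t.
Proof.
move=> tourT ul sl srch /allP Lq codeE /(search_sound srch); rewrite -codeE.
case/orP => [/hasP[k kL av] | /hasP[t tin iso]]; last by right; exists t.
have /andP[/eqP szk ltk] := Lq k kL.
by left; apply/(dichi_codeP tourT x0 ul sl); exists k.
Qed.

Lemma card_exhaustive (T : finType) (l : seq T) :
  uniq l -> (forall x, x \in l) -> size l = #|T|.
Proof. by move=> /card_uniqP <- inl; apply: eq_card => x; rewrite inl. Qed.

Fixpoint words (q n : nat) : seq (seq nat) :=
  if n is n'.+1 then [seq c :: w | c <- iota 0 q, w <- words q n'] else [:: [::]].

Lemma mem_words q k : all (fun c => c < q) k -> k \in words q (size k).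
Proof.
elim: k => //= c k IHk /andP[ltc /IHk inw].
by apply: (allpairs_f (@cons nat)); rewrite // mem_iota.
Qed.

(** Exhaustion: none of the q-colourings, listed as words, is good. *)
Lemma dichi_gt (T : oriented_graph) (x0 : T) (l : seq T) (q : nat) (t : seq bitseq) :
  tournament T -> uniq l -> size l = #|T| -> code x0 l = t ->
  ~~ lazy_has (avoids (size l) (code_arc t)) (words q (size l)) -> q < dichi T.
Proof.
move=> tourT ul sl <-; rewrite lazy_hasE ltnNge; apply: contra.
case/(dichi_codeP tourT x0 ul sl) => k [szk ltk] av.
by apply/hasP; exists k; rewrite // -szk mem_words.
Qed.

(** * The three exceptional tournaments and the searches *)

Definition T5_vertices : seq T5star := [:: T5h; T5l; T5m0; T5m1; T5m2].

(** Evaluated once, so that the searches work on literal bits and not on the finite type. *)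
Definition T5_matrix : seq bitseq := Eval vm_compute in code (T5h : T5star) T5_vertices.

Definition P7_vertices : seq P7 := [seq (inZp i : 'Z_7) | i <- iota 0 7].

Definition P7_matrix : seq bitseq := Eval vm_compute in code (inZp 0 : P7) P7_vertices.

Definition Q7_vertices : seq Q7 := [:: Q7x1; Q7x2; Q7x3; Q7x4; Q7u; Q7v; Q7w].

Definition Q7_matrix : seq bitseq := Eval vm_compute in code (Q7x1 : Q7) Q7_vertices.

Local Notation any := (@None bool).
Local Notation yes := (Some true).
Local Notation no := (Some false).

(* Found by a greedy covering of the tournaments that the search reaches and that
   are not isomorphic to a target; [colourings7] likewise. *)
Definition colourings5 : seq (seq nat) :=
  [:: [:: 0; 0; 0; 1; 1]; [:: 0; 0; 1; 0; 1]; [:: 0; 0; 1; 1; 0]; [:: 0; 1; 0; 0; 1]].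

(** The stored rows make 0, 1, 2 transitive, with arcs from smaller to larger; the other two
    vertices contribute seven free arcs. *)
Lemma search_transitive_triple :
  search 5 colourings5 [:: T5_matrix]
    [:: [:: any; any; any]; [:: any; any; any; any]]
    [:: [::]; [:: false]; [:: false; false]].
Proof. by vm_compute. Qed.

Definition colourings7 : seq (seq nat) :=
  [:: [:: 0; 0; 0; 0; 1; 1; 2]; [:: 0; 0; 0; 0; 1; 2; 1]; [:: 0; 0; 0; 0; 2; 1; 1];
      [:: 0; 1; 1; 2; 2; 1; 0]; [:: 0; 1; 2; 2; 0; 0; 1]; [:: 0; 1; 1; 2; 1; 0; 2];
      [:: 0; 1; 0; 0; 1; 2; 2]; [:: 0; 1; 1; 2; 0; 2; 1]; [:: 0; 0; 1; 0; 2; 2; 1];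
      [:: 0; 0; 1; 2; 2; 1; 1]; [:: 0; 1; 2; 1; 2; 0; 0]; [:: 0; 1; 2; 2; 0; 1; 0];
      [:: 0; 1; 1; 0; 2; 0; 2]; [:: 0; 1; 0; 1; 2; 0; 2]; [:: 0; 0; 1; 2; 1; 2; 1];
      [:: 0; 1; 1; 2; 1; 2; 2]; [:: 0; 0; 0; 1; 2; 1; 0]].

(** The stored rows make 0, 1, 2, 3 transitive, and the entries [no] encode the path 4, 5, 6.
    Thirteen arcs remain free, among them the one between 4 and 6. *)
Lemma search_transitive_quadruple :
  search 7 colourings7 [:: P7_matrix; Q7_matrix]
    [:: [:: any; any; any; any]; [:: any; any; any; any; no]; [:: any; any; any; any; any; no]]
    [:: [::]; [:: false]; [:: false; false]; [:: false; false; false]].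
Proof. by vm_compute. Qed.

(** Vertex 0 dominates the directed triangle 1, 2, 3 and is dominated by the directed triangle 4, 5,
    6; the nine arcs between the triangles are free. *)
Lemma search_cyclic_neighbourhoods :
  search 7 colourings7 [:: P7_matrix; Q7_matrix]
    [:: [:: yes; any; any; any]; [:: yes; any; any; any; no];
        [:: yes; any; any; any; yes; no]]
    [:: [::]; [:: false]; [:: false; false]; [:: false; true; false]].
Proof. by vm_compute. Qed.

Lemma T5_tournament : tournament T5star.
Proof. by case; case. Qed.

Lemma Q7_tournament : tournament Q7.
Proof. by case; case. Qed.

Lemma mem_P7_vertices (x : P7) : x \in P7_vertices.
Proof. by apply/mapP; exists (val x); rewrite ?mem_iota ?valZpK // ltn_ord. Qed.

Lemma P7_tournament : tournament P7.
Proof.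
move=> x y; apply/implyP; move: x y.
suff /allP chk : all (fun x => all (fun y => (x != y) ==> (arc P7 x y (+) arc P7 y x))
    P7_vertices) P7_vertices.
  by move=> x y; have /allP -> := chk x (mem_P7_vertices x); rewrite ?mem_P7_vertices.
by vm_compute.
Qed.

Lemma T5_verticesP : uniq T5_vertices /\ size T5_vertices = #|T5star|.
Proof. by split=> //; apply: card_exhaustive => //; case. Qed.

Lemma P7_verticesP : uniq P7_vertices /\ size P7_vertices = #|P7|.
Proof. by split=> //; apply: card_exhaustive => //; exact: mem_P7_vertices. Qed.

Lemma Q7_verticesP : uniq Q7_vertices /\ size Q7_vertices = #|Q7|.
Proof. by split=> //; apply: card_exhaustive => //; case. Qed.

Lemma T5_dichi : dichi T5star = 3.
Proof.
have [ul sl] := T5_verticesP.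
apply/eqP; rewrite eqn_leq; apply/andP; split.
  apply/(dichi_codeP T5_tournament (T5h : T5star) ul sl).
  by exists [:: 0; 0; 1; 1; 2]; vm_compute.
by apply: (@dichi_gt _ (T5h : T5star) _ _ T5_matrix T5_tournament ul sl); vm_compute.
Qed.

Lemma P7_dichi : dichi P7 = 4.
Proof.
have [ul sl] := P7_verticesP.
apply/eqP; rewrite eqn_leq; apply/andP; split.
  apply/(dichi_codeP P7_tournament (inZp 0 : P7) ul sl).
  by exists [:: 0; 0; 0; 1; 2; 1; 3]; vm_compute.
by apply: (@dichi_gt _ (inZp 0 : P7) _ _ P7_matrix P7_tournament ul sl); vm_compute.
Qed.

Lemma Q7_dichi : dichi Q7 = 4.
Proof.
have [ul sl] := Q7_verticesP.
apply/eqP; rewrite eqn_leq; apply/andP; split.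
  (* The transitive quadruple is one class and u, v, w are singletons: an alternating 4-cycle would
     need two vertices in each of two classes. *)
  apply/(dichi_codeP Q7_tournament (Q7x1 : Q7) ul sl).
  by exists [:: 0; 0; 0; 0; 1; 2; 3]; vm_compute.
by apply: (@dichi_gt _ (Q7x1 : Q7) _ _ Q7_matrix Q7_tournament ul sl); vm_compute.
Qed.

Lemma T5_inneighbour (y : T5star) : exists x, arc T5star x y.
Proof. by case: y; [exists T5l | exists T5m0 | exists T5h | exists T5h | exists T5h]. Qed.

Lemma P7_inneighbour (y : P7) : exists x, arc P7 x y.
Proof. by exists (y - 1)%R; rewrite /arc /= /P7_arc GRing.subKr. Qed.

Lemma Q7_inneighbour (y : Q7) : exists x, arc Q7 x y.
Proof.
by case: y; [exists Q7v | exists Q7x1 | exists Q7x1 | exists Q7x1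
  | exists Q7x1 | exists Q7u | exists Q7x2].
Qed.

(* Some vertex of Q7 has out-degree 4, but P7 is 3-regular. *)
Lemma P7_Q7_not_isomorphic : ~ isomorphic P7 Q7.
Proof.
case/isomorphic_sym => f [/bij_inj inj_f arcf].
have outP7 (x y : P7) : arc P7 x y -> y \in [:: x + 1; x + 2; x + 4]%R.
  have yE : y = (x + (y - x))%R by rewrite GRing.addrC GRing.subrK.
  by rewrite /= /P7_arc !inE => /or3P[] /eqP yx; rewrite {1 2 3}yE yx eqxx ?orbT.
have := @uniq_leq_size _ (map f [:: Q7x2; Q7x3; Q7x4; Q7u])
  [:: f Q7x1 + 1; f Q7x1 + 2; f Q7x1 + 4]%R.
rewrite (map_inj_uniq inj_f) => /(_ isT) le43.
suff /le43 : {subset map f [:: Q7x2; Q7x3; Q7x4; Q7u] <=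
  [:: f Q7x1 + 1; f Q7x1 + 2; f Q7x1 + 4]%R} by [].
move=> _ /mapP[y y4 ->]; apply: outP7; rewrite arcf.
by move: y4; rewrite !inE => /or4P[] /eqP->.
Qed.

(** * Classification in orders five and seven *)

Lemma card_notin (T : finType) (l : seq T) : uniq l -> #|[set x | x \notin l]| = #|T| - size l.
Proof.
move=> /card_uniqP <-; rewrite -(cardC (mem l)) addKn; apply: eq_card => x.
by rewrite !inE.
Qed.

Lemma tournament5 (T : oriented_graph) :
  tournament T -> #|T| = 5 -> 2 < dichi T -> isomorphic T T5star.
Proof.
move=> tourT T5 dichiT.
have [x [y [z [_ [xy xz yz]]]]] : transitive_triple [set: T].
  by apply: exists_transitive_triple; rewrite // cardsT T5.
have xyz_uniq : uniq [:: x; y; z].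
  by rewrite /= !inE negb_or (arc_neq xy) (arc_neq xz) (arc_neq yz).
have : 1 < #|[set t | t \notin [:: x; y; z]]| by rewrite card_notin // T5.
case/card_gt1P => u [v []]; rewrite inE => u_new; rewrite inE => v_new neq_uv.
pose l := [:: x; y; z; u; v].
have ul : uniq l.
  rewrite -[l]/([:: x; y; z] ++ [:: u; v]) cat_uniq xyz_uniq /= (negPf u_new) (negPf v_new).
  by rewrite inE neq_uv.
have sl : size l = #|T| by rewrite T5.
have [ul' sl'] := T5_verticesP.
(* The rows of u and v instantiate the free patterns. A good colouring with two colours would
   contradict [dichiT], which leaves the isomorphism with the target. *)
have [||/(leq_trans dichiT)|[t]] := @search_tournament T x l 2 _ _ _ _
  [:: [:: arc T u x; arc T u y; arc T u z]; [:: arc T v x; arc T v y; arc T v z; arc T v u]]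
  tourT ul sl search_transitive_triple isT => //.
- rewrite /code /mkseq /=.
  by rewrite (negPf (no_opposite xy)) (negPf (no_opposite xz)) (negPf (no_opposite yz)).
rewrite inE => /eqP -> iso.
by apply: (isomorphic_codesP (x0' := (T5h : T5star)) tourT T5_tournament ul sl ul' sl' _ iso).
Qed.

Lemma tournament7 (T : oriented_graph) :
  tournament T -> #|T| = 7 -> 3 < dichi T -> isomorphic T P7 \/ isomorphic T Q7.
Proof.
move=> tourT T7 dichiT.
have targetP x l t : uniq l -> size l = #|T| -> t \in [:: P7_matrix; Q7_matrix] ->
    isomorphic_codes (size l) (code (x : T) l) t -> isomorphic T P7 \/ isomorphic T Q7.
  move=> ul sl; rewrite !inE => /orP[] /eqP -> iso.
    have [ul' sl'] := P7_verticesP; left.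
    apply: (isomorphic_codesP (x0' := (inZp 0 : P7)) tourT P7_tournament ul sl ul' sl' _ iso).
    by rewrite sl T7.
  have [ul' sl'] := Q7_verticesP; right.
  apply: (isomorphic_codesP (x0' := (Q7x1 : Q7)) tourT Q7_tournament ul sl ul' sl' _ iso).
  by rewrite sl T7.
have [[x1 [x2 [x3 [x4 [[x12 x13 x14] [x23 x24 x34]]]]]] | [a [cyc_out cyc_in]]] :=
  transitive_quadruple_or_cyclic_neighbourhoods tourT T7.
  have x_uniq : uniq [:: x1; x2; x3; x4].
    rewrite /= !inE !negb_or (arc_neq x12) (arc_neq x13) (arc_neq x14).
    by rewrite (arc_neq x23) (arc_neq x24) (arc_neq x34).
  have : 2 < #|[set t | t \notin [:: x1; x2; x3; x4]]| by rewrite card_notin // T7.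
  (* The other three vertices are named along a directed path, to match the [no] entries of the
     patterns. *)
  case/(triple_path tourT) => u [v [w [[]]]].
  rewrite inE => u_new; rewrite inE => v_new; rewrite inE => w_new [uv vw neq_uw].
  pose l := [:: x1; x2; x3; x4; u; v; w].
  have ul : uniq l.
    rewrite -[l]/([:: x1; x2; x3; x4] ++ [:: u; v; w]) cat_uniq x_uniq /=.
    rewrite (negPf u_new) (negPf v_new) (negPf w_new) !inE /= negb_or.
    by rewrite (arc_neq uv) (arc_neq vw) neq_uw.
  have sl : size l = #|T| by rewrite T7.
  have [||/(leq_trans dichiT)|[t]] := @search_tournament T x1 l 3 _ _ _ _
    [:: [seq arc T u x | x <- [:: x1; x2; x3; x4]];
        [seq arc T v x | x <- [:: x1; x2; x3; x4; u]];
        [seq arc T w x | x <- [:: x1; x2; x3; x4; u; v]]]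
    tourT ul sl search_transitive_quadruple isT => //; last exact: targetP.
  - rewrite /code /mkseq /= (negPf (no_opposite x12)) (negPf (no_opposite x13)).
    rewrite (negPf (no_opposite x14)) (negPf (no_opposite x23)).
    by rewrite (negPf (no_opposite x24)) (negPf (no_opposite x34)).
  - rewrite /fits /=.
    by rewrite (negPf (no_opposite uv)) (negPf (no_opposite vw)).
case: cyc_out => b [c [d [[]]]]; rewrite !inE => ab ac ad [bc cd db].
case: cyc_in => u [v [w [[]]]]; rewrite !inE => ua va wa [uv vw wu].
have across x y : arc T a x -> arc T y a -> x != y.
  by move=> ax; apply: contraTneq => <-; apply: no_opposite.
pose l := [:: a; b; c; d; u; v; w].
have ul : uniq l.
  rewrite /= !inE !negb_or (arc_neq ab) (arc_neq ac) (arc_neq ad) (arc_neq bc) (arc_neq cd).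
  rewrite [b == d]eq_sym (arc_neq db) (arc_neq uv) (arc_neq vw) [u == w]eq_sym (arc_neq wu).
  rewrite ![a == _]eq_sym (arc_neq ua) (arc_neq va) (arc_neq wa).
  by rewrite !across.
have sl : size l = #|T| by rewrite T7.
have [||/(leq_trans dichiT)|[t]] := @search_tournament T a l 3 _ _ _ _
  [:: [seq arc T u x | x <- [:: a; b; c; d]];
      [seq arc T v x | x <- [:: a; b; c; d; u]];
      [seq arc T w x | x <- [:: a; b; c; d; u; v]]]
  tourT ul sl search_cyclic_neighbourhoods isT => //; last exact: targetP.
- rewrite /code /mkseq /= (negPf (no_opposite ab)) (negPf (no_opposite ac)) db.
  by rewrite (negPf (no_opposite ad)) (negPf (no_opposite bc)) (negPf (no_opposite cd)).
- rewrite /fits /= ua va wa wu.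
  by rewrite (negPf (no_opposite uv)) (negPf (no_opposite vw)).
Qed.

(** * The minimum orders m(3) and m(4) *)

Lemma order_lower_bound (k n : nat) :
  (forall T : oriented_graph, tournament T -> #|T| = n -> k <= dichi T ->
     forall y : T, exists x, arc T x y) ->
  forall D : oriented_graph, k <= dichi D -> n <= #|D|.
Proof.
move=> no_source D kD; rewrite leqNgt; apply/negP => /tournament_with_source[T].
case=> tourT Tn DT [s srcs]; have [x] := no_source T tourT Tn (leq_trans kD DT) s.
by rewrite (negPf (srcs x)).
Qed.

Theorem theorem1p3 :
  [/\ min_order 3 5, min_order 4 7,
      forall T : oriented_graph,
        [/\ tournament T, #|T| = 5 & 3 <= dichi T] <-> isomorphic T T5star,
      (forall T : oriented_graph,
        [/\ tournament T, #|T| = 7 & 4 <= dichi T] <->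
        isomorphic T P7 \/ isomorphic T Q7)
      /\ ~ isomorphic P7 Q7
    & [/\ dichi T5star = 3, dichi P7 = 4 & dichi Q7 = 4]].
Proof.
have [T5_card P7_card Q7_card] : [/\ #|T5star| = 5, #|P7| = 7 & #|Q7| = 7].
  by split; [case: T5_verticesP | case: P7_verticesP | case: Q7_verticesP].
split.
- split; first by exists T5star; rewrite T5_dichi.
  apply: order_lower_bound => T tourT T5 dichiT.
  exact: isomorphic_inneighbour (tournament5 tourT T5 dichiT) T5_inneighbour.
- split; first by exists P7; rewrite P7_dichi.
  apply: order_lower_bound => T tourT T7 dichiT.
  have [iso|iso] := tournament7 tourT T7 dichiT.
    exact: isomorphic_inneighbour iso P7_inneighbour.
  exact: isomorphic_inneighbour iso Q7_inneighbour.
- move=> T; split=> [[tourT T5 dichiT] | iso]; first exact: tournament5.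
  rewrite (isomorphic_card iso) (isomorphic_dichi iso) T5_dichi; split=> //.
  exact: isomorphic_tournament iso T5_tournament.
- split; last exact: P7_Q7_not_isomorphic.
  move=> T; split=> [[tourT T7 dichiT] | [] iso]; first exact: tournament7.
    rewrite (isomorphic_card iso) (isomorphic_dichi iso) P7_dichi; split=> //.
    exact: isomorphic_tournament iso P7_tournament.
  rewrite (isomorphic_card iso) (isomorphic_dichi iso) Q7_dichi; split=> //.
  exact: isomorphic_tournament iso Q7_tournament.
- by split; [exact: T5_dichi | exact: P7_dichi | exact: Q7_dichi].
Qed.
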